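(* Let $k,m,n$ be natural numbers with $2\le k<n$ and $n\le 2m<2n$, and put $p=\frac mn$, $\varepsilon=\frac kn$. Let $X_1,\dots,X_n$ be independent random variables with $\mathbf{Pr}(X_i=1)=p$ and $\mathbf{Pr}(X_i=0)=1-p$. Then $$\mathbf{Pr}\left(\left|\frac1n\sum_{i=1}^nX_i-p\right|>\varepsilon\right)<\exp\left\{-\frac{2\varepsilon^2n}{1+\varepsilon^2}\right\}.$$ *)

(* Defs.v *)
From HB Require Import structures.
From mathcomp Require Import all_boot all_order all_algebra.
From mathcomp Require Import all_classical all_reals all_analysis.

Set Implicit Arguments.
Unset Strict Implicit.
Unset Printing Implicit Defensive.

Import Order.TTheory GRing.Theory Num.Theory.

Local Open Scope classical_set_scope.
Local Open Scope ring_scope.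

(** Mutual (not merely pairwise) independence of a finite family of random
    variables. *)
Definition mutually_independent (d d' : measure_display)
    (T : measurableType d) (T' : measurableType d') (R : realType)
    (P : probability T R) (I : finType) (X : I -> {RV P >-> T'}) : Prop :=
  forall (J : {set I}) (B : I -> set T'),
    (forall i, i \in J -> measurable (B i)) ->
    P (\bigcap_(i in [set` J]) (X i @^-1` B i)) =
      (\prod_(i in J) P (X i @^-1` B i))%E.

(* Main.v *)
Require Import Defs.
From HB Require Import structures.
From mathcomp Require Import all_boot all_order all_algebra.
From mathcomp Require Import all_classical all_reals all_analysis.
From mathcomp Require Import ring lra zify.

Set Implicit Arguments.
Unset Strict Implicit.
Unset Printing Implicit Defensive.

Import Order.TTheory GRing.Theory Num.Theory.

Local Open Scope classical_set_scope.
Local Open Scope ring_scope.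

(** Write [S] for the sum of the [X i]; it is binomial with mean the integer
    [m], and [n - m] is positive.  The event says that [S] lies outside the
    window of radius [k] around [m].  The proof gives the bound
    [exp (- 2 k^2 / n)], which is the claimed one without the denominator
    [1 + eps^2], hence smaller.

    Let [g k = exp (- 2 k^2 / n)] and let [T k] be the probability that [S] is
    at distance more than [k] from [m].  The point is to compare decrements
    rather than values.  When the radius grows from [j] to [j + 1], the tail
    [T] loses the binomial masses of [m + j + 1] and [m - j - 1].  Each of these
    masses is at most [exp (- 4 j / n)] times the one a step closer to the mean
    ([binom_mass_up], [binom_mass_down]), while this exponential is a lower bound
    for the ratio of consecutive decrements of [g] ([gauss_increment]).  So once
    a decrement of [T] is at most the corresponding decrement of [g], it remains
    so, and [g - T] first increases and then decreases.  Such a sequence is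
    positive between two points where it is positive ([quasiconcave_gt0]), and
    it is positive at both ends: at [0] since [T 0] is [1] minus the mass of
    [m], and at [n] since [T n] vanishes.  This is [window_mass_gt].

    The bound on the ratio of masses is where the integrality of the mean
    enters: with [M = m] and [N = n - m] the ratio on the upper side is
    [M (N - j) / ((M + j + 1) N)].  It is estimated by induction on [j]
    ([ratio_bound]), every step being an instance of
    [(1 - u) / (1 + u) <= exp (- 2 u)].  The lower side is the upper side with
    successes and failures exchanged.

    The passage from random variables to binomial masses only needs a lower
    bound on the probability of the window ([binom_mass_le_probability]): the
    2^n atoms prescribing every [X i] to be [0] or [1] are disjoint and have
    product probabilities by independence. *)

(** * Exponential bounds for ratios *)

(** Multiplied by [expR u], the difference of the two sides becomes
    [(1 + x) exp (- x) - (1 - x) exp x], which vanishes at [0] and has derivative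
    [x (exp x - exp (- x))], nonnegative for [x >= 0]. *)
Lemma one_minus_le_expR (R : realType) (u : R) : 0 <= u ->
  1 - u <= expR (- (2 * u)) * (1 + u).
Proof.
move=> u0.
pose h (x : R) := (1 + x) * expR (- x) - (1 - x) * expR x.
pose dh (x : R) := x * (expR x - expR (- x)).
have hd (x : R^o) : is_derive x (1 : R^o) (h : R^o -> R^o) (dh x).
  rewrite /h; apply: is_derive_eq.
  rewrite /dh /GRing.scale /=; ring.
have h0 : h 0 = 0 by rewrite /h oppr0 addr0 subrr.
have : h 0 <= h u.
  apply: (@ger0_derive1_ndecr _ h 0 u) => //.
  - move=> x; rewrite in_itv /= => /andP[x0 _].
    rewrite derive1E (@derive_val _ _ _ _ _ _ _ (hd x)) /dh mulr_ge0 ?ltW //.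
    by rewrite subr_gt0 ltr_expR; lra.
  - by apply: derivable_within_continuous => x _; exact: ex_derive.
rewrite h0 /h subr_ge0 => hu.
have -> : - (2 * u) = - u + - u by ring.
rewrite -(ler_pM2r (expR_gt0 u)) (le_trans hu) // expRD.
have -> : expR (- u) * expR (- u) * (1 + u) * expR u =
   (1 + u) * expR (- u) * (expR u * expR (- u)) by ring.
by rewrite expRxMexpNx_1 mulr1.
Qed.

(** The preceding bound at [u = 1 / (2 x + 1)], for which
    [(1 - u) / (1 + u) = x / (x + 1)]. *)
Lemma le_expR_succ (R : realType) (x : R) : 0 < x ->
  x <= expR (- (2 / (2 * x + 1))) * (x + 1).
Proof.
move=> x0; set u := (2 * x + 1)^-1.
have u0 : 0 < u by rewrite invr_gt0; lra.
have := one_minus_le_expR (ltW u0).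
rewrite -(ler_pM2r (_ : 0 < x + 1 / 2)); last by lra.
have -> : (1 - u) * (x + 1 / 2) = x by rewrite /u; field; lra.
rewrite -mulrA.
by have -> : (1 + u) * (x + 1 / 2) = x + 1 by rewrite /u; field; lra.
Qed.

(** With [a = x] and [b = y + 1] of sum [s + 2], the product
    [(1 - 1/a) (1 - 1/b)] is largest at [a = b], where it is [(s / (s + 2))^2]. *)
Lemma two_point_ratio_le (R : realFieldType) (x y s E : R) :
  1 <= x -> 0 < y -> x + y = s + 1 -> 0 < E -> s <= E * (s + 2) ->
  (x - 1) * y <= E ^+ 2 * (x * (y + 1)).
Proof.
move=> x1 y0 xy E0 sE.
have s0 : 0 < s by lra.
have amgm : (x - 1) * y * (s + 2) ^+ 2 <= s ^+ 2 * (x * (y + 1)).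
  have -> : s = x + y - 1 by lra.
  rewrite -subr_ge0.
  have -> : (x + y - 1) ^+ 2 * (x * (y + 1)) - (x - 1) * y * (x + y - 1 + 2) ^+ 2
    = (x + y) * (x - y - 1) ^+ 2 by ring.
  by rewrite mulr_ge0 ?sqr_ge0 //; lra.
rewrite -(ler_pM2r (_ : 0 < (s + 2) ^+ 2)); last by rewrite exprn_gt0 //; lra.
apply: le_trans amgm _; rewrite [leRHS]mulrAC -exprMn ler_pM2r; last first.
  by rewrite mulr_gt0 //; lra.
by rewrite lerXn2r // nnegrE; lra.
Qed.

(** The bound on the ratio of two neighbouring masses.  At [j = 0] the ratio is
    [M / (M + 1)], and passing from [j] to [j + 1] multiplies it by the product
    in [two_point_ratio_le] with [s = M + N], at most
    [exp (- 4 / (M + N + 1))]. *)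
Lemma ratio_bound (R : realType) (M N : R) (j : nat) :
  0 < M -> 0 < N -> j%:R <= N ->
  M * (N - j%:R) <=
  expR (- (2 / (2 * M + 1) + 4 * j%:R / (M + N + 1))) * ((M + j%:R + 1) * N).
Proof.
move=> M0 N0; elim: j => [|j IH] jN.
  rewrite mulr0n mulr0 mul0r !addr0 subr0 mulrA ler_pM2r //.
  exact: le_expR_succ.
rewrite -natr1 in jN *.
have {IH} := IH ltac:(lra).
set x := N - j%:R; set y := M + j%:R + 1; set F := expR _ => IH.
have x1 : 1 <= x by rewrite /x; lra.
have y0 : 0 < y by rewrite /y ltr_wpDl // addr_ge0 // ltW.
have F0 : 0 < F by exact: expR_gt0.
have := @le_expR_succ R ((M + N) / 2) ltac:(lra).
have -> : 2 * ((M + N) / 2) + 1 = M + N + 1 by field.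
set E := expR _ => hE.
have E0 : 0 < E by exact: expR_gt0.
have := @two_point_ratio_le _ x y (M + N) E x1 y0 ltac:(rewrite /x /y; lra) E0 ltac:(lra).
move=> step.
have -> : expR (- (2 / (2 * M + 1) + 4 * (j%:R + 1) / (M + N + 1))) = F * E ^+ 2.
  rewrite /F /E -expRM_natl -expRD; congr expR.
  by field; lra.
have -> : N - (j%:R + 1) = x - 1 by rewrite /x; ring.
have -> : M + (j%:R + 1) + 1 = y + 1 by rewrite /y; ring.
rewrite -(ler_pM2l (_ : 0 < x)); last by lra.
have -> : x * (M * (x - 1)) = (M * x) * (x - 1) by ring.
apply: (@le_trans _ _ (F * (y * N) * (x - 1))).
  by rewrite ler_wpM2r //; lra.
have -> : F * (y * N) * (x - 1) = (F * N) * ((x - 1) * y) by ring.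
have -> : x * (F * E ^+ 2 * ((y + 1) * N)) = (F * N) * (E ^+ 2 * (x * (y + 1))) by ring.
by rewrite ler_wpM2l // mulr_ge0 // ltW.
Qed.

(** The term [2 / (2 M + 1)] left over from [j = 0] pays for replacing
    [M + N + 1] by [M + N]: for [j <= N] the requirement reduces to
    [(N - M) (N - M - 1) >= 0], which holds because [M] and [N] are integers. *)
Lemma gaussian_ratio_bound (R : realType) (M N j : nat) :
  (0 < M)%N -> (0 < N)%N -> (j <= N)%N ->
  M%:R * (N - j)%:R <=
  expR (- (4 * j%:R / (M + N)%:R)) * ((M + j).+1%:R * N%:R) :> R.
Proof.
move=> M0 N0 jN.
have M1 : 0 < M%:R :> R by rewrite ltr0n.
have N1 : 0 < N%:R :> R by rewrite ltr0n.
have jN1 : j%:R <= N%:R :> R by rewrite ler_nat.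
have -> : (M + j).+1%:R = M%:R + j%:R + 1 :> R by rewrite -natr1 natrD.
rewrite natrB //; apply: le_trans (ratio_bound M1 N1 jN1) _.
rewrite ler_wpM2r //.
rewrite ler_expR lerN2 natrD.
set m : R := M%:R in M1 *; set n : R := N%:R in N1 jN1 *.
have consec : 0 <= (n - m) * (n - m - 1).
  rewrite /m /n; have [NM|MN] := leqP N M.
    have NM1 : N%:R <= M%:R :> R by rewrite ler_nat.
    by rewrite -mulrNN mulr_ge0 //; lra.
  have : M.+1%:R <= N%:R :> R by rewrite ler_nat.
  by rewrite -natr1 => MN1; rewrite mulr_ge0 //; lra.
have j0 : 0 <= j%:R :> R by [].
set t : R := j%:R in j0 jN1 *.
have key : 4 * t / ((m + n) * (m + n + 1)) <= 2 / (2 * m + 1).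
  rewrite ler_pdivrMr; last by rewrite mulr_gt0; lra.
  rewrite mulrAC ler_pdivlMr; last by lra.
  apply: (@le_trans _ _ (4 * n * (2 * m + 1))).
    by rewrite ler_wpM2r //; lra.
  rewrite -subr_ge0.
  have -> : 2 * ((m + n) * (m + n + 1)) - 4 * n * (2 * m + 1) =
    2 * ((n - m) * (n - m - 1)) by ring.
  lra.
have -> : 4 * t / (m + n) = 4 * t / ((m + n) * (m + n + 1)) + 4 * t / (m + n + 1).
  by field; lra.
lra.
Qed.

(** * Binomial masses *)

Definition binom_mass (R : pzRingType) (n : nat) (p : R) (i : nat) : R :=
  'C(n, i)%:R * p ^+ i * (1 - p) ^+ (n - i).

Lemma binom_mass_small (R : pzRingType) n (p : R) i :
  (n < i)%N -> binom_mass n p i = 0.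
Proof. by move=> ni; rewrite /binom_mass bin_small // !mul0r. Qed.

Lemma binom_mass_sum (R : comPzRingType) n (p : R) N :
  (n < N)%N -> \sum_(0 <= i < N) binom_mass n p i = 1.
Proof.
move=> nN; rewrite (@big_cat_nat _ _ _ n.+1) //=.
rewrite [X in _ + X]big_nat_cond [X in _ + X]big1 ?addr0; last first.
  by move=> i /andP[/andP[ni _] _]; exact: binom_mass_small.
have -> : 1 = (1 - p + p) ^+ n by rewrite subrK expr1n.
rewrite exprDn big_mkord; apply: eq_bigr => i _.
by rewrite /binom_mass -mulrA mulr_natl [p ^+ i * _]mulrC.
Qed.

Lemma binom_mass_sym (R : comPzRingType) n (p : R) i :
  (i <= n)%N -> binom_mass n (1 - p) (n - i) = binom_mass n p i.
Proof.
by move=> ni; rewrite /binom_mass bin_sub // subKn // subKr mulrAC.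
Qed.

Lemma binom_mass_succ (R : comPzRingType) n (p : R) i :
  binom_mass n p i.+1 * (i.+1%:R * (1 - p)) =
  binom_mass n p i * ((n - i)%:R * p).
Proof.
have [ni|ni] := leqP n i.
  by rewrite binom_mass_small // mul0r (eqP ni : n - i = 0)%N mul0r mulr0.
have E : i.+1%:R * 'C(n, i.+1)%:R = (n - i)%:R * 'C(n, i)%:R :> R.
  by rewrite -!natrM mul_bin_left.
have qE : (1 - p) ^+ (n - i) = (1 - p) ^+ (n - i.+1) * (1 - p).
  by rewrite -exprSr subnSK.
rewrite /binom_mass qE exprS.
transitivity ((i.+1%:R * 'C(n, i.+1)%:R) * (p ^+ i * p)
  * ((1 - p) ^+ (n - i.+1) * (1 - p))); first by ring.
by rewrite E; ring.
Qed.

Lemma binom_mass_ge0 (R : realDomainType) n (p : R) i :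
  0 <= p <= 1 -> 0 <= binom_mass n p i.
Proof.
by case/andP=> p0 p1; rewrite !mulr_ge0 // exprn_ge0 // subr_ge0.
Qed.

Lemma binom_mass_up (R : realType) (M N j : nat) :
  (0 < M)%N -> (0 < N)%N ->
  binom_mass (M + N) (M%:R / (M + N)%:R) (M + j.+1) <=
  expR (- (4 * j%:R / (M + N)%:R)) *
    binom_mass (M + N) (M%:R / (M + N)%:R) (M + j) :> R.
Proof.
move=> M0 N0; set n := (M + N)%N; set p : R := M%:R / n%:R.
have M1 : 0 < M%:R :> R by rewrite ltr0n.
have N1 : 0 < N%:R :> R by rewrite ltr0n.
have n1 : 0 < n%:R :> R by rewrite natrD addr_gt0.
have q : 1 - p = N%:R / n%:R by rewrite /p /n natrD; field; lra.
have p0 : 0 <= p by rewrite divr_ge0 // ltW.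
have p1 : p <= 1 by rewrite -subr_ge0 q divr_ge0 // ltW.
have b0 i : 0 <= binom_mass n p i by rewrite binom_mass_ge0 // p0.
have [Nj|jN] := ltnP N j.
  rewrite binom_mass_small; last by rewrite /n; lia.
  by rewrite mulr_ge0 ?expR_ge0.
have den : 0 < (M + j).+1%:R * (1 - p) by rewrite q mulr_gt0 // divr_gt0.
rewrite -(ler_pM2r den) addnS binom_mass_succ.
have -> : (n - (M + j) = N - j)%N by rewrite /n; lia.
rewrite [leRHS]mulrAC [leRHS]mulrC ler_wpM2l // q /p !mulrA.
rewrite ler_wpM2r ?invr_ge0 ?(ltW n1) // [leLHS]mulrC -[leRHS]mulrA.
exact: gaussian_ratio_bound.
Qed.

(** Exchanging success and failure turns this into [binom_mass_up] with [M] and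
    [N] swapped: the bound there is symmetric in the two numbers. *)
Lemma binom_mass_down (R : realType) (M N j : nat) :
  (0 < M)%N -> (0 < N)%N -> (j < M)%N ->
  binom_mass (M + N) (M%:R / (M + N)%:R) (M - j.+1) <=
  expR (- (4 * j%:R / (M + N)%:R)) *
    binom_mass (M + N) (M%:R / (M + N)%:R) (M - j) :> R.
Proof.
move=> M0 N0 jM; set n := (M + N)%N; set p : R := M%:R / n%:R.
have q : 1 - p = N%:R / (N + M)%:R.
  rewrite /p /n addnC; have : 0 < (N + M)%:R :> R by rewrite ltr0n; lia.
  by rewrite natrD => nm; field; lra.
have := @binom_mass_up R N M j N0 M0; rewrite -q addnC -/n.
have -> : (N + j.+1 = n - (M - j.+1))%N by rewrite /n; lia.
have -> : (N + j = n - (M - j))%N by rewrite /n; lia.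
by rewrite !binom_mass_sym // /n; lia.
Qed.

(** * Comparison of the two tails *)

(** If the sequence has started to decrease by [k], it stays above its value at
    [N] from there on; otherwise it has been increasing since [0]. *)
Lemma quasiconcave_gt0 (R : realDomainType) (D : nat -> R) (N k : nat) :
  (forall j, D j.+1 <= D j -> D j.+2 <= D j.+1) ->
  0 < D 0%N -> 0 < D N -> (k <= N)%N -> 0 < D k.
Proof.
move=> Dqc D0 DN kN.
have stays_down i j : D i.+1 <= D i -> (i <= j)%N -> D j.+1 <= D j <= D i.
  move=> Di; elim: j => [|j IH].
    by rewrite leqn0 => /eqP <-; rewrite Di lexx.
  rewrite leq_eqVlt => /predU1P[<-|/IH]; first by rewrite Di lexx.
  by case/andP=> Dj Dji; rewrite Dqc //= (le_trans Dj).
have [up|down] := ltP (D k) (D k.+1); last first.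
  by apply: lt_le_trans DN _; case/andP: (stays_down k N down kN).
have : forall j, (j <= k)%N -> D 0%N <= D j.
  elim=> // j IH jk; apply: le_trans (IH (ltnW jk)) _.
  have [/ltW//|Dj] := ltP (D j) (D j.+1).
  by have /andP[] := stays_down _ _ Dj (ltnW jk); rewrite leNgt up.
by move/(_ k (leqnn k)); exact: lt_le_trans.
Qed.

(** Since [j^2 + 2 (j + 1) = (j + 1)^2 + 1] and
    [(j + 1)^2 + 2 (j + 1) = (j + 2)^2 - 1], the exponential factor moves
    both terms on the left one step further up to a factor [exp (- c)] on the
    first and [exp c] on the second. *)
Lemma gauss_increment (R : realType) (c : R) (j : nat)
    (g := fun i : nat => expR (- (c * i%:R ^+ 2))) : 0 <= c ->
  expR (- (2 * c * j.+1%:R)) * (g j - g j.+1) <= g j.+1 - g j.+2.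
Proof.
move=> c0; rewrite mulrBr /g -!expRD.
have -> : - (2 * c * j.+1%:R) + - (c * j%:R ^+ 2) = - (c * j.+1%:R ^+ 2) - c.
  by rewrite -natr1; ring.
have -> : - (2 * c * j.+1%:R) + - (c * j.+1%:R ^+ 2) = - (c * j.+2%:R ^+ 2) + c.
  by rewrite -[in RHS]natr1; ring.
rewrite lerB // ler_expR; lra.
Qed.

(** The lower end is truncated at [0], so that a radius larger than [m] is
    harmless. *)
Definition window_mass (R : pzRingType) (n : nat) (p : R) (m k : nat) : R :=
  \sum_(m - k <= i < (m + k).+1) binom_mass n p i.

Lemma window_massS (R : comPzRingType) n (p : R) m k :
  window_mass n p m k.+1 = window_mass n p m k +
    (binom_mass n p (m + k.+1) +
     if (k < m)%N then binom_mass n p (m - k.+1) else 0).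
Proof.
rewrite /window_mass addnS big_nat_recr /=; last by lia.
case: ltnP => km.
  rewrite big_ltn; last by lia.
  by rewrite subnSK //; ring.
have -> : (m - k.+1 = m - k)%N by lia.
by rewrite addr0.
Qed.

(** Here [g k - (1 - window_mass k)] is the sequence to which
    [quasiconcave_gt0] applies. *)
Lemma window_mass_gt (R : realType) (M N k : nat) :
  (0 < M)%N -> (0 < N)%N -> (k <= M + N)%N ->
  1 - window_mass (M + N) (M%:R / (M + N)%:R) M k <
  expR (- (2 * k%:R ^+ 2 / (M + N)%:R)) :> R.
Proof.
move=> M0 N0; set n := (M + N)%N; set p : R := M%:R / n%:R => kn.
have n1 : 0 < n%:R :> R by rewrite ltr0n /n; lia.
pose c : R := 2 / n%:R.
have c0 : 0 <= c by rewrite divr_ge0 // ltW.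
pose g (i : nat) := expR (- (c * i%:R ^+ 2)).
pose W := window_mass n p M.
have -> : expR (- (2 * k%:R ^+ 2 / n%:R)) = g k by rewrite /g /c mulrAC.
rewrite -subr_gt0 -/(W k).
have q : 1 - p = N%:R / n%:R.
  by rewrite /p; move: n1; rewrite /n natrD => n1; field; lra.
have WS i : W i.+1 - W i = binom_mass n p (M + i.+1) +
    (if (i < M)%N then binom_mass n p (M - i.+1) else 0).
  by rewrite /W window_massS addrAC subrr add0r.
apply: (@quasiconcave_gt0 _ (fun k => g k - (1 - W k)) n) => // [j Dj| |].
- have := @gauss_increment R c j c0; rewrite -/(g j) -/(g j.+1) -/(g j.+2).
  have -> : 2 * c * j.+1%:R = 4 * j.+1%:R / n%:R by rewrite /c; field; lra.
  set e := expR _ => dg.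
  have e0 : 0 <= e by exact: expR_ge0.
  (* beyond the left end 0 of the range, the lower mass is zero *)
  have dW : W j.+2 - W j.+1 <= e * (W j.+1 - W j).
    rewrite !WS mulrDr lerD ?binom_mass_up //.
    case: (ltnP j.+1 M) => [jM|_]; first by rewrite (ltnW jM) binom_mass_down.
    case: ifP => _; last by rewrite mulr0.
    by rewrite mulr_ge0 // binom_mass_ge0 // -[p <= 1]subr_ge0 q !divr_ge0.
  have : 0 <= e * (g j - (1 - W j) - (g j.+1 - (1 - W j.+1))).
    by rewrite mulr_ge0 // subr_ge0.
  lra.
- rewrite /g expr0n mulr0 oppr0 expR0 opprB addrC subrK.
  rewrite /W /window_mass subn0 addn0 big_nat1 /binom_mass q.
  have p0 : 0 < p by rewrite /p divr_gt0 // ltr0n.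
  have q0 : 0 < N%:R / n%:R :> R by rewrite divr_gt0 // ltr0n.
  by rewrite !mulr_gt0 ?exprn_gt0 // ltr0n bin_gt0 leq_addr.
- have -> : W n = 1.
    rewrite /W /window_mass (_ : M - n = 0)%N; last by rewrite /n; lia.
    by apply: binom_mass_sum; lia.
  by rewrite subrr subr0 expR_gt0.
Qed.

(** * From independent variables to binomial masses *)

Lemma binom_mass_draws (R : comPzRingType) n (p : R) a b :
  \sum_(a <= i < b) binom_mass n p i =
  \sum_(J : {set 'I_n} | (a <= #|J| < b)%N) p ^+ #|J| * (1 - p) ^+ (n - #|J|).
Proof.
transitivity (\sum_(a <= i < b) \sum_(J : {set 'I_n} | #|J| == i)
    p ^+ #|J| * (1 - p) ^+ (n - #|J|)).
  apply: eq_bigr => i _.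
  rewrite (eq_bigr (fun=> p ^+ i * (1 - p) ^+ (n - i))); last by move=> J /eqP ->.
  rewrite sumr_const.
  have -> : #|[pred J : {set 'I_n} | #|J| == i]| = 'C(n, i).
    rewrite -[n in RHS]card_ord -card_draws.
    by apply: eq_card => J; rewrite !inE.
  by rewrite /binom_mass -mulrA mulr_natl.
rewrite (exchange_big_dep xpredT) //= [RHS]big_mkcond /=.
apply: eq_bigr => J _.
by under eq_bigl do rewrite eq_sym; rewrite big_nat1_eq.
Qed.

(** The hypothesis on [A] concerns only outcomes where the sum is an integer in
    the given range; the atoms where every [X i] is [0] or [1] suffice, so the
    remaining null set never has to be discussed. *)
Lemma binom_mass_le_probability (R : realType) (d : measure_display)
    (T : measurableType d) (P : probability T R) (n : nat) (p : R)
    (X : 'I_n -> {RV P >-> R}) (a b : nat) (A : set T) :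
  mutually_independent X ->
  (forall i, P [set w | X i w = 1] = p%:E) ->
  (forall i, P [set w | X i w = 0] = (1 - p)%:E) ->
  measurable A ->
  (forall w c, (a <= c < b)%N -> \sum_(i < n) X i w = c%:R -> A w) ->
  ((\sum_(a <= i < b) binom_mass n p i)%:E <= P A)%E.
Proof.
move=> hind hX1 hX0 mA AX.
pose B (J : {set 'I_n}) i : set R := [set (i \in J)%:R].
pose E (J : {set 'I_n}) := \bigcap_(i in [set` [set: 'I_n]%SET]) (X i @^-1` B J i).
have EX J w : E J w -> forall i, X i w = (i \in J)%:R.
  by move=> EJ i; apply: EJ; rewrite /= inE.
have mE J : measurable (E J).
  apply: fin_bigcap_measurable => // i _.
  by apply: measurable_funPTI; exact: measurable_set1.
have PE J : P (E J) = (p ^+ #|J| * (1 - p) ^+ (n - #|J|))%:E.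
  rewrite hind; last by move=> i _; exact: measurable_set1.
  have PB i : P (X i @^-1` B J i) = (if i \in J then p else 1 - p)%:E.
    by rewrite /B; case: (i \in J); [exact: hX1 | exact: hX0].
  under eq_bigr do rewrite PB.
  rewrite prodEFin; congr EFin.
  under eq_bigl do rewrite inE.
  rewrite (bigID (mem J)) /=; congr (_ * _).
    by rewrite (eq_bigr (fun=> p)) ?prodr_const // => i ->.
  rewrite (eq_bigr (fun=> 1 - p)) => [|i /negbTE -> //].
  rewrite (eq_bigl (fun i => i \in ~: J)) => [|i]; last by rewrite !inE.
  by rewrite prodr_const cardsCs finset.setCK card_ord.
pose Q (J : {set 'I_n}) := (a <= #|J| < b)%N.
rewrite binom_mass_draws -sumEFin.
rewrite (eq_bigr (fun J => P (E J))) => [|J _]; last by rewrite PE.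
rewrite bigfs; [|exact: index_enum_uniq|by move=> J _; rewrite mem_index_enum].
rewrite -measure_fin_bigcup //; last first.
  move=> J J' _ _ [w [EJ EJ']]; apply/setP => i.
  have := EX _ _ EJ i; rewrite (EX _ _ EJ' i) => /eqP.
  by rewrite eqr_nat; case: (i \in J); case: (i \in J').
apply: le_measure; rewrite ?inE //.
  exact: fin_bigcup_measurable.
move=> w [J /= QJ EJ]; apply: (AX _ #|J|) => //.
rewrite (eq_bigr (fun i => (i \in J)%:R)); last by move=> i _; exact: EX.
by rewrite -natr_sum -sum1_card [in RHS]big_mkcond.
Qed.

Theorem corollary3 (R : realType) (d : measure_display) (T : measurableType d)
    (P : probability T R) (k m n : nat)
    (hk2 : (2 <= k)%N) (hkn : (k < n)%N)
    (hnm : (n <= 2 * m)%N) (hmn : (2 * m < 2 * n)%N)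
    (p eps : R) (hp : p = m%:R / n%:R) (heps : eps = k%:R / n%:R)
    (X : 'I_n -> {RV P >-> R})
    (hind : mutually_independent X)
    (hX1 : forall i, P [set w | X i w = 1] = p%:E)
    (hX0 : forall i, P [set w | X i w = 0] = (1 - p)%:E) :
  (P [set w | (eps < `| n%:R^-1 * (\sum_(i < n) X i w) - p |)%R]
     < (expR (- (2 * eps ^+ 2 * n%:R / (1 + eps ^+ 2))))%:E)%E.
Proof.
have n0 : 0 < n%:R :> R by rewrite ltr0n; lia.
set A := [set w | _].
have mA : measurable A.
  have mf : measurable_fun setT
      (fun w => `| n%:R^-1 * (\sum_(i < n) X i w) - p | : R).
    apply: measurableT_comp => //; apply: measurable_realfun.measurable_funB => //.
    by apply: measurable_realfun.measurable_funM => //; exact: measurable_sum.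
  rewrite (_ : A = setT `&` (fun w =>
      `| n%:R^-1 * (\sum_(i < n) X i w) - p |) @^-1` `]eps, +oo[%classic).
    by apply: mf => //; exact: measurable_itv.
  by rewrite setTI; apply/seteqP; split=> w; rewrite /A /= in_itv /= andbT.
have AC w c : (m - k <= c < (m + k).+1)%N -> \sum_(i < n) X i w = c%:R -> (~` A) w.
  move=> ck Xc; rewrite /A /= Xc hp heps; apply/negP; rewrite -leNgt.
  have -> : n%:R^-1 * c%:R - m%:R / n%:R = (c%:R - m%:R) / n%:R :> R by ring.
  rewrite normrM [X in _ * X]ger0_norm ?invr_ge0 ?(ltW n0) //.
  rewrite ler_pM2r ?invr_gt0 // ler_norml.
  have h1 : m%:R <= (c + k)%:R :> R by rewrite ler_nat; lia.
  have h2 : c%:R <= (m + k)%:R :> R by rewrite ler_nat; lia.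
  rewrite !natrD in h1 h2; lra.
have := binom_mass_le_probability hind hX1 hX0 (measurableC mA) AC.
rewrite probability_setC // => window.
have := @window_mass_gt R m (n - m) k; rewrite subnKC; last by lia.
rewrite -hp /window_mass => /(_ ltac:(lia) ltac:(lia) ltac:(lia)).
set W : R := \sum_(_ <= _ < _) _ in window * => gt.
have PA : (P A <= (1 - W)%:E)%E.
  by rewrite EFinB leeBrDr // addeC -leeBrDr ?fin_num_measure.
apply: le_lt_trans PA _; rewrite lte_fin; apply: lt_le_trans gt _.
(* dividing the exponent by [1 + eps^2] only weakens the bound *)
rewrite ler_expR lerN2.
have -> : 2 * k%:R ^+ 2 / n%:R = 2 * eps ^+ 2 * n%:R :> R.
  by rewrite heps; field; lra.
rewrite ler_pdivrMr; last by rewrite ltr_wpDr ?sqr_ge0.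
rewrite ler_peMr // ?lerDl ?sqr_ge0 //.
by apply: mulr_ge0 => //; apply: mulr_ge0 => //; exact: sqr_ge0.
Qed.
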